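(* Let $W$ be a real-valued random variable with mean $0$ and variance $\sigma^2$, let $W^\star$ have the $W$-zero-biased distribution, and assume that $W^\star\leq_{cx}W$. Then, for all differentiable $g:\mathbb{R}\to\mathbb{R}$ such that $\mathrm{Var}[g(W)]$ exists (is finite) and the function $x\mapsto g'(x)^2$ is convex, $$\mathrm{Var}[g(W)]\leq\sigma^2\,\mathbb{E}[g'(W)^2].$$
   Context: For a real-valued random variable $W$ with mean zero and finite variance $\sigma^2$, a random variable $W^\star$ is said to have the $W$-zero-biased distribution if $$\mathbb{E}[W\phi(W)]=\sigma^2\,\mathbb{E}[\phi'(W^\star)]$$ for all absolutely continuous functions $\phi:\mathbb{R}\to\mathbb{R}$ for which the expectations exist. (Such a $W^\star$ always exists and its law is unique.) For random variables $X$ and $Y$, $X$ is smaller than $Y$ in the convex order, written $X\leq_{cx}Y$, if $\mathbb{E}[\phi(X)]\leq\mathbb{E}[\phi(Y)]$ for all convex functions $\phi:\mathbb{R}\to\mathbb{R}$ for which the expectations exist. *)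

(* Defs.v *)
From HB Require Import structures.
From mathcomp Require Import all_boot all_order all_algebra.
From mathcomp Require Import all_classical all_reals all_analysis.

Set Implicit Arguments.
Unset Strict Implicit.
Unset Printing Implicit Defensive.

Import Order.TTheory GRing.Theory Num.Theory.
Import numFieldNormedType.Exports.

Local Open Scope classical_set_scope.
Local Open Scope ring_scope.

(* ab ranges over finite families of subintervals of [a, b] with pairwise
   disjoint interiors. *)
Definition absolutely_continuous_on (R : realType) (a b : R) (f : R -> R) :=
  forall e : R, 0 < e -> exists2 d : R, 0 < d &
    forall (n : nat) (ab : 'I_n -> R * R),
      (forall i, a <= (ab i).1 /\ (ab i).1 <= (ab i).2 /\ (ab i).2 <= b) ->
      trivIset setT (fun i => `](ab i).1, (ab i).2[%classic) ->
      \sum_(i < n) ((ab i).2 - (ab i).1) < d ->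
      \sum_(i < n) `|f (ab i).2 - f (ab i).1| < e.

(* Absolute continuity on R is understood on every compact interval (so that
   polynomials qualify), equivalently f is the indefinite integral of a locally
   integrable function. *)
Definition absolutely_continuous (R : realType) (f : R -> R) :=
  forall a b : R, absolutely_continuous_on a b f.

(* Ws has the W-zero-biased distribution, for W of mean zero and finite
   variance. W and Ws may live on different probability spaces. "The
   expectations exist" is integrability, i.e. membership in L^1. An absolutely
   continuous phi is differentiable almost everywhere; where it is not, the
   total function derive1 phi takes a default value. *)
Definition zero_biased (d d' : measure_display) (T : measurableType d)
    (T' : measurableType d') (R : realType)
    (P : probability T R) (Q : probability T' R)
    (W : {RV P >-> R}) (Ws : {RV Q >-> R}) :=
  forall phi : R -> R, absolutely_continuous phi ->
    (fun w => W w * phi (W w)) \in Lfun P 1%E ->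
    derive1 phi \o Ws \in Lfun Q 1%E ->
    ('E_P[fun w => (W w * phi (W w))%R] =
      'V_P[W] * 'E_Q[derive1 phi \o Ws])%E.

Definition convex (R : realType) (phi : R -> R) :=
  convex_function [set: convex_lmodType R^o] phi.

(* "The expectations exist" is again integrability. *)
Definition convex_order (d d' : measure_display) (T : measurableType d)
    (T' : measurableType d') (R : realType)
    (P : probability T R) (Q : probability T' R)
    (X : {RV P >-> R}) (Y : {RV Q >-> R}) :=
  forall phi : R -> R, convex phi ->
    phi \o X \in Lfun P 1%E ->
    phi \o Y \in Lfun Q 1%E ->
    ('E_P[phi \o X] <= 'E_Q[phi \o Y])%E.

(* Main.v *)
Require Import Defs.
From HB Require Import structures.
From mathcomp Require Import all_boot all_order all_algebra.
From mathcomp Require Import all_classical all_reals all_analysis.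
From mathcomp Require Import measurable_realfun ring lra.

(** Let h be the square of the derivative of g and H its primitive vanishing at
    0. Cauchy-Schwarz on the segment from 0 to w gives
    (g w - g 0)^2 <= w * H w ([sqr_increment_le]), so the variance of g(W) is at
    most E[W H(W)]. By zero-biasing this is sigma^2 E[h(Ws)], and since h is
    convex the convex order bounds it by sigma^2 E[h(W)].

    The difficulty is integrability, as zero-biasing and the convex order are
    only available for integrable functions, while W is merely square
    integrable. Zero-biasing extends to every nonnegative continuous function,
    as an identity between possibly infinite integrals, by truncating the
    function at height n and letting n grow ([zero_biased_nneg]).

    For the convex order, h is the increasing limit of its Lipschitz envelopes
    h_n, which are convex ([lipschitz_envelope_convex]). Integrability of h_n(W)
    is clear because h_n grows linearly. That of h_n(Ws) amounts, by
    zero-biasing again, to that of W H_n(W) with H_n a primitive of h_n, a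
    function of cubic growth. It is the finite variance of g(W) that controls it
    ([truncated_growth]): on a half-line where h stays below h(0), w H_n(w) grows
    only quadratically; on a half-line where h exceeds h(0) somewhere, convexity
    forces h to grow at least linearly, hence g^2 at least cubically. Monotone
    convergence then carries the inequality from h_n to h
    ([convex_order_sqr_derive]). *)

Import Order.TTheory GRing.Theory Num.Theory.
Import numFieldNormedType.Exports.

Local Open Scope classical_set_scope.
Local Open Scope ring_scope.

Set Implicit Arguments.
Unset Strict Implicit.
Unset Printing Implicit Defensive.

(** * Primitives and the mean value theorem *)

Lemma is_derive_continuous (R : realType) (F dF : R -> R) :
  (forall x : R, is_derive x 1 F (dF x)) -> continuous F.
Proof.
by move=> dFP x; apply/differentiable_continuous/derivable1_diffP.
Qed.

(** Locating t by inequalities that do not depend on the sign of x lets both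
    half-lines be treated at once. *)
Lemma mvt_from0 (R : realType) (F dF : R -> R) (x : R) :
  (forall y : R, is_derive y 1 F (dF y)) ->
  exists t, [/\ `|t| <= `|x|, 0 <= t * x & F x - F 0 = dF t * x].
Proof.
move=> dFP; have cF := is_derive_continuous dFP.
have [x0|x0] := leP 0 x.
  have [t] := MVT_segment x0 (fun y _ => dFP y) (continuous_subspaceT cF).
  rewrite in_itv/= subr0 => /andP[t0 tx] ->.
  by exists t; rewrite !ger0_norm// mulr_ge0.
have [t] := MVT_segment (ltW x0) (fun y _ => dFP y) (continuous_subspaceT cF).
rewrite in_itv/= sub0r => /andP[tx t0] Ft; exists t.
split; last by lra.
- by rewrite !ler0_norm ?(ltW x0)// lerN2.
- by rewrite mulr_le0// ltW.
Qed.

Lemma mul_primitive_ge0 (R : realType) (F dF : R -> R) (x : R) :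
  (forall y : R, is_derive y 1 F (dF y)) -> F 0 = 0 ->
  (forall t, `|t| <= `|x| -> 0 <= dF t) -> 0 <= x * F x.
Proof.
move=> dFP F0 dF0; have [t [tx _]] := mvt_from0 x dFP.
by rewrite F0 subr0 => ->; rewrite mulrCA -expr2 mulr_ge0 ?sqr_ge0 ?dF0.
Qed.

Lemma le_mul_primitive (R : realType) (F dF G dG : R -> R) (x : R) :
  (forall y : R, is_derive y 1 F (dF y)) -> F 0 = 0 ->
  (forall y : R, is_derive y 1 G (dG y)) -> G 0 = 0 ->
  (forall t, `|t| <= `|x| -> dF t <= dG t) -> x * F x <= x * G x.
Proof.
move=> dFP F0 dGP G0 dFG; rewrite -subr_ge0 -mulrBr.
apply: (@mul_primitive_ge0 _ (G - F) (fun t => dG t - dF t)).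
- by rewrite !fctE F0 G0 subr0.
- by move=> t /dFG; rewrite subr_ge0.
Qed.

(** Cauchy-Schwarz for the integral of g' against 1 on the segment from 0 to x,
    obtained without integrating: for every l, the function
    l^2 t + H t - 2 l (g t - g 0) has derivative (g' t - l)^2, and the bound is
    the optimal choice of l. *)
Lemma sqr_increment_le (R : realType) (g dg H : R -> R) (x : R) :
  (forall y : R, is_derive y 1 g (dg y)) ->
  (forall y : R, is_derive y 1 H (dg y ^+ 2)) -> H 0 = 0 ->
  (g x - g 0) ^+ 2 <= x * H x.
Proof.
move=> dgP dHP H0; have [->|x0] := eqVneq x 0.
  by rewrite subrr mul0r expr0n.
pose l := (g x - g 0) / x.
pose F : R -> R := H - (l *: (2 *: g - l *: id) - cst (l * 2 * g 0)).
have : 0 <= x * F x.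
  apply: (@mul_primitive_ge0 _ _
      (fun t => dg t ^+ 2 - (l *: (2 *: dg t - l *: 1) - 0))).
  - by rewrite /F !fctE H0 /GRing.scale/=; ring.
  - move=> t _; have := sqr_ge0 (dg t - l).
    by rewrite /GRing.scale/=; congr (_ <= _); ring.
have -> : x * F x = x * H x - (g x - g 0) ^+ 2.
  by rewrite /F !fctE /GRing.scale/= /l; field.
by rewrite subr_ge0.
Qed.

(** The fundamental theorem of calculus produces primitives on half-lines only;
    normalised to vanish at 0 they agree wherever they are both defined, so that
    they can be glued. *)
Lemma exists_primitive (R : realType) (k : R -> R) : continuous k ->
  exists2 K : R -> R, (forall x : R, is_derive x 1 K (k x)) & K 0 = 0.
Proof.
move=> ck.
pose F (a x : R) := \int[lebesgue_measure]_(t in `[a, x]) k t.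
have dF (a x : R) : a < x -> is_derive x 1 (F a) (k x).
  move=> ax.
  have [//|||dd <-] := @continuous_FTC1_closed _ k a x (x + 1) _ _ ax _.
  - by rewrite ltrDl.
  - apply: continuous_compact_integrable; first exact: segment_compact.
    exact: continuous_subspaceT.
  - exact: ck.
  - by rewrite derive1E; apply: DeriveDef.
(* the base point moves with x so as to stay to the left of both x and 0 *)
pose K x := F (- `|x| - 1) x - F (- `|x| - 1) 0.
have KE (a x : R) : a < 0 -> a < x -> K x = F a x - F a 0.
  move=> a0 ax; rewrite /K; set b := _ - 1.
  have b0 : b < 0 by rewrite /b; have := normr_ge0 x; lra.
  have bx : b < x by rewrite /b; have := ler_norm (- x); rewrite normrN; lra.
  have dd (y : R) : Num.min 0 x <= y ->
      is_derive y 1 (fun z => F b z - F a z) (k y - k y).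
    rewrite ge_min => h; have [ay byy] : a < y /\ b < y by case/orP: h; lra.
    by apply: is_deriveB; exact: dF.
  (* F b - F a has zero derivative on a half-line containing 0 and x *)
  suff : F b x - F a x = F b 0 - F a 0 by lra.
  have mvt (u v : R) : u <= v -> Num.min 0 x <= u ->
      F b u - F a u = F b v - F a v.
    move=> uv mu.
    have [y||t _] := @MVT_segment _ (fun z => F b z - F a z)
      (fun y => k y - k y) _ _ uv.
    - by rewrite in_itv/= => /andP[uy _]; apply/dd/(le_trans mu)/ltW.
    - apply: derivable_within_continuous => y; rewrite in_itv/= => /andP[uy _].
      by have dy := dd _ (le_trans mu uy); exact: ex_derive.
    by rewrite subrr mul0r => /eqP; rewrite subr_eq0 => /eqP.
  by have [x0|x0] := leP 0 x; [symmetry|]; apply: mvt => //;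
    rewrite ?(ltW x0)// ge_min lexx ?orbT.
exists K => [x|]; last by rewrite /K subrr.
pose a := - `|x| - 1.
have a0 : a < 0 by rewrite /a; have := normr_ge0 x; lra.
have ax : a < x by rewrite /a; have := ler_norm (- x); rewrite normrN; lra.
have : is_derive x 1 (F a - cst (F a 0)) (k x).
  by rewrite -[k x]subr0; apply: is_deriveB; exact: dF.
apply: near_eq_is_derive.
by near=> z; rewrite !fctE (KE a)//; near: z; exact: lt_nbhsr.
Unshelve. all: by end_near. Qed.

(** * Convex functions and their Lipschitz envelopes *)

Lemma convexP (R : realType) (h : R -> R) :
  convex h <-> forall x y a b : R, 0 <= a -> 0 <= b -> a + b = 1 ->
    h (a * x + b * y) <= a * h x + b * h y.
Proof.
split=> [hh x y a b a0 b0 ab1|hh t x y _ _].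
  have a1 : a <= 1 by lra.
  have -> : b = 1 - a by lra.
  by have := hh (Itv01 a0 a1) x y (in_setT _) (in_setT _).
by apply: (hh x y t%:num (1 - t%:num)) => //; rewrite addrC subrK.
Qed.

Lemma convex_chord (R : realType) (h : R -> R) (x y z : R) :
  convex h -> x < y -> y < z ->
  (z - x) * h y <= (z - y) * h x + (y - x) * h z.
Proof.
move=> /convexP hh xy yz; have zx : 0 < z - x by lra.
rewrite -ler_pdivlMl// mulrDr !mulrA ![_^-1 * _]mulrC.
have {1}-> : y = (z - y) / (z - x) * x + (y - x) / (z - x) * z.
  by field; rewrite gt_eqF.
apply: hh; try by rewrite divr_ge0//; lra.
by field; rewrite gt_eqF.
Qed.

(** On the ball of radius M the slopes of a nonnegative convex function are
    controlled by its values at the two points at distance 1 from the ball: the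
    chord from x to M + 1 has slope at most h (M + 1). The point y is arbitrary,
    which is what makes the envelope below coincide with h on the ball. *)
Lemma convex_locally_lipschitz (R : realType) (h : R -> R) (M x y : R) :
  convex h -> (forall z, 0 <= h z) -> `|x| <= M ->
  h x <= h y + (h (M + 1) + h (- (M + 1))) * `|x - y|.
Proof.
move=> hh h0 xM.
have [xM1 Mx] : - M <= x /\ x <= M by apply/andP; rewrite -ler_norml.
have [p0 n0 x0 d0] := And4 (h0 (M + 1)) (h0 (- (M + 1))) (h0 x) (normr_ge0 (x - y)).
have [hxy|hyx] := leP (h x) (h y).
  by rewrite (le_trans hxy)// lerDl mulr_ge0// addr_ge0.
have [yx|xy|->] := ltgtP y x; last by rewrite subrr normr0 mulr0 addr0.
(* the sign conditions left open in mulr_ge0 are linear, hence found by lra *)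
- have xM2 : x < M + 1 by lra.
  have := convex_chord hh yx xM2; rewrite gtr0_norm ?subr_gt0//.
  have := mulr_ge0 (_ : 0 <= M - x) (_ : 0 <= h x - h y).
  have := mulr_ge0 (_ : 0 <= x - y) n0; have := mulr_ge0 (_ : 0 <= x - y) x0.
  by lra.
- have xM2 : - (M + 1) < x by lra.
  have := convex_chord hh xM2 xy; rewrite ltr0_norm ?subr_lt0//.
  have := mulr_ge0 (_ : 0 <= M + x) (_ : 0 <= h x - h y).
  have := mulr_ge0 (_ : 0 <= y - x) p0; have := mulr_ge0 (_ : 0 <= y - x) x0.
  by lra.
Qed.

Lemma convex_continuous (R : realType) (h : R -> R) :
  convex h -> (forall z, 0 <= h z) -> continuous h.
Proof.
move=> hh h0 x.
pose M := `|x| + 1; pose L := h (M + 1) + h (- (M + 1)) + 1.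
have L0 : 0 < L by rewrite /L; have := h0 (M + 1); have := h0 (- (M + 1)); lra.
apply/cvgrPdist_le => e e0.
near=> y.
have yM : `|y| <= M.
  have : `|x - y| <= 1 by near: y; apply: cvgr_dist_le => //; exact: cvg_id.
  by rewrite /M distrC => xy; have := ler_normD x (y - x); rewrite addrC subrK; lra.
have xM : `|x| <= M by rewrite /M; lra.
have : `|x - y| <= e / L.
  by near: y; apply: cvgr_dist_le; rewrite ?divr_gt0//; exact: cvg_id.
rewrite ler_pdivlMr// mulrC => xyL.
have := convex_locally_lipschitz y hh h0 xM.
have := convex_locally_lipschitz x hh h0 yM.
rewrite distrC => h1 h2.
have LE : h (M + 1) + h (- (M + 1)) = L - 1 by rewrite /L; lra.
move: h1 h2; rewrite LE mulrBl mul1r => h1 h2.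
have := normr_ge0 (x - y).
by rewrite ler_norml; lra.
Unshelve. all: by end_near. Qed.

(** The infimal convolution of h with L * `|x|, that is the largest L-Lipschitz
    minorant of h when there is one. *)
Definition lipschitz_envelope (R : realType) (h : R -> R) (L x : R) : R :=
  inf [set h y + L * `|x - y| | y in [set: R]].

Section lipschitz_envelope.
Context (R : realType) (h : R -> R).
Hypothesis h0 : forall x, 0 <= h x.
Implicit Types L x y : R.

Local Notation env := (lipschitz_envelope h).

Lemma lipschitz_envelope_lb L x c :
  (forall y, c <= h y + L * `|x - y|) -> c <= env L x.
Proof.
move=> cP; apply: lb_le_inf.
  by exists (h x + L * `|x - x|); exists x.
by move=> _ [y _ <-].
Qed.

Lemma lipschitz_envelope_le L x y : 0 <= L -> env L x <= h y + L * `|x - y|.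
Proof.
move=> L0; apply: ge_inf; last by exists y.
by exists 0 => _ [z _ <-]; rewrite addr_ge0// mulr_ge0.
Qed.

Lemma lipschitz_envelope_ge0 L x : 0 <= L -> 0 <= env L x.
Proof.
by move=> L0; apply: lipschitz_envelope_lb => y; rewrite addr_ge0// mulr_ge0.
Qed.

Lemma lipschitz_envelope_le_id L x : 0 <= L -> env L x <= h x.
Proof.
move=> L0; have := lipschitz_envelope_le x x L0.
by rewrite subrr normr0 mulr0 addr0.
Qed.

Lemma lipschitz_envelope_nd L L' x :
  0 <= L -> L <= L' -> env L x <= env L' x.
Proof.
move=> L0 LL'; apply: lipschitz_envelope_lb => y.
by rewrite (le_trans (lipschitz_envelope_le x y L0))// lerD2l ler_wpM2r.
Qed.

(** The function (x, y) |-> h y + L * `|x - y| is jointly convex, and so is its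
    infimum in y. *)
Lemma lipschitz_envelope_convex L : 0 <= L -> convex h -> convex (env L).
Proof.
move=> L0 /convexP hh; apply/convexP => x y a b a0 b0 ab1.
apply/ler_addgt0Pr => e e0.
have near_inf z : exists w, h w + L * `|z - w| < env L z + e.
  have [//|_ [w _ <-] we] :=
    @inf_adherent _ [set h y + L * `|z - y| | y in [set: R]] e e0.
    split; first by exists (h z + L * `|z - z|); exists z.
    by exists 0 => _ [w _ <-]; rewrite addr_ge0// mulr_ge0.
  by exists w.
have [u uP] := near_inf x; have [v vP] := near_inf y.
apply: (le_trans (lipschitz_envelope_le _ (a * u + b * v) L0)).
have : `|a * x + b * y - (a * u + b * v)| <= a * `|x - u| + b * `|y - v|.
  rewrite -[a in leRHS]ger0_norm// -[b in leRHS]ger0_norm// -!normrM.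
  apply: le_trans (ler_normD _ _); rewrite le_eqVlt; apply/orP; left.
  by apply/eqP; congr `| _ |; ring.
move=> /(ler_wpM2l L0).
have := hh u v a b a0 b0 ab1.
have := ler_wpM2l a0 (ltW uP); have := ler_wpM2l b0 (ltW vP).
have -> : b = 1 - a by lra.
nra.
Qed.

Lemma lipschitz_envelope_eq M x L : convex h -> `|x| <= M ->
  h (M + 1) + h (- (M + 1)) <= L -> env L x = h x.
Proof.
move=> hh xM ML; apply/eqP; rewrite eq_le lipschitz_envelope_le_id/=; last first.
  by rewrite (le_trans _ ML)// addr_ge0.
apply: lipschitz_envelope_lb => y.
rewrite (le_trans (convex_locally_lipschitz y hh h0 xM))// lerD2l.
by rewrite ler_wpM2r.
Qed.

End lipschitz_envelope.

(** * Growth of g when the square of its derivative is convex *)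

Lemma convex_secant_le (R : realType) (h : R -> R) (y x : R) :
  convex h -> 0 < y -> y <= x -> (h y - h 0) * x <= y * (h x - h 0).
Proof.
move=> hh y0; rewrite le_eqVlt => /predU1P[<-|yx]; first by rewrite mulrC.
by have := convex_chord hh y0 yx; lra.
Qed.

(** If (g')^2 grows at least like s z, then g should grow like the primitive
    (2 / 3) sqrt s z^(3/2) of sqrt (s z). Cauchy's mean value theorem compares
    the two increments whatever the sign of g'; the substitution z = w^2 turns
    z^(3/2) into the polynomial w^3. *)
Lemma sqr_increment_ge_cube (R : realType) (g dg : R -> R) (s y x : R) :
  (forall z : R, is_derive z 1 g (dg z)) -> 0 < y -> y <= x ->
  (forall z, y <= z -> s * z <= dg z ^+ 2) ->
  4 * s * (x * Num.sqrt x - y * Num.sqrt y) ^+ 2 <= 9 * (g x - g y) ^+ 2.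
Proof.
move=> dgP y0; rewrite le_eqVlt => /predU1P[<- _|yx dgs].
  by rewrite !subrr expr0n !mulr0.
have [u u0 ux] : exists2 u, 0 < u & u ^+ 2 = x.
  by exists (Num.sqrt x); rewrite ?sqr_sqrtr ?sqrtr_gt0//; lra.
have [v v0 vy] : exists2 v, 0 < v & v ^+ 2 = y.
  by exists (Num.sqrt y); rewrite ?sqr_sqrtr ?sqrtr_gt0//; lra.
rewrite -ux -vy !sqrtr_sqr !gtr0_norm// -!exprSr.
have vu : v < u by rewrite -(ltr_pXn2r (n := 2)) ?nnegrE ?ltW// ux vy.
pose f : R -> R := g \o id ^+ 2; pose q : R -> R := id ^+ 3.
have df (w : R) : is_derive w 1 f (dg (w ^+ 2) * (2 * w)).
  have -> : dg (w ^+ 2) * (2 * w) = dg ((id ^+ 2 : R -> R) w) * ((2%:R * id w ^+ 1) *: 1).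
    by rewrite /GRing.scale/= mulr1 !fctE.
  exact: is_derive1_comp.
have dq (w : R) : is_derive w 1 q (3 * w ^+ 2).
  have -> : 3 * w ^+ 2 = (3%:R * id w ^+ 2) *: 1 by rewrite /GRing.scale/= mulr1.
  exact: is_deriveX.
have [||w|c] := @cauchy_MVT _ f (fun w => dg (w ^+ 2) * (2 * w)) q
    (fun w => 3 * w ^+ 2) v u vu _ _ (fun w _ => df w) (fun w _ => dq w).
- exact/continuous_subspaceT/(is_derive_continuous df).
- exact/continuous_subspaceT/(is_derive_continuous dq).
- rewrite in_itv/= => /andP[vw _].
  by rewrite mulf_neq0// expf_neq0// gt_eqF// (lt_trans v0).
rewrite in_itv/= => /andP[vc cu].
have c0 : 0 < c by exact: lt_trans vc.
have quv : 0 < u ^+ 3 - v ^+ 3.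
  by rewrite subr_gt0 ltr_pXn2r ?nnegrE ?ltW.
have dqc0 : 3 * c ^+ 2 != 0 by rewrite mulf_neq0// expf_neq0// gt_eqF.
rewrite /f /q /= !fctE => /eqP; rewrite eqr_div ?(gt_eqF quv)// => /eqP E.
have hc : s * c ^+ 2 <= dg (c ^+ 2) ^+ 2.
  by apply: dgs; rewrite -vy ler_pXn2r ?nnegrE ?ltW.
have E2 : 4 * dg (c ^+ 2) ^+ 2 * (u ^+ 3 - v ^+ 3) ^+ 2 =
    9 * c ^+ 2 * (g (u ^+ 2) - g (v ^+ 2)) ^+ 2.
  apply: (@mulfI _ (c ^+ 2)); first by rewrite expf_neq0// gt_eqF.
  transitivity ((dg (c ^+ 2) * (2 * c) * (u ^+ 3 - v ^+ 3)) ^+ 2); first by ring.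
  by rewrite E; ring.
rewrite -(@ler_pM2l _ (c ^+ 2)) ?exprn_gt0//.
have -> : c ^+ 2 * (9 * (g (u ^+ 2) - g (v ^+ 2)) ^+ 2) =
  4 * dg (c ^+ 2) ^+ 2 * (u ^+ 3 - v ^+ 3) ^+ 2 by rewrite E2; ring.
have -> : c ^+ 2 * (4 * s * (u ^+ 3 - v ^+ 3) ^+ 2) =
  4 * (s * c ^+ 2) * (u ^+ 3 - v ^+ 3) ^+ 2 by ring.
by rewrite ler_wpM2r ?sqr_ge0// ler_wpM2l.
Qed.

(** By convexity, h = (g')^2 lies above its secant through 0 and y on the right of
    y; since h 0 is nonnegative this gives h z >= s z there, with s the slope of
    that secant. *)
Lemma cube_le_sqr (R : realType) (g dg : R -> R) (y : R) :
  (forall z : R, is_derive z 1 g (dg z)) -> convex (fun z => dg z ^+ 2) ->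
  0 < y -> dg 0 ^+ 2 < dg y ^+ 2 ->
  exists2 K, 0 <= K & forall x, 0 <= x -> x ^+ 3 <= K * (1 + g x ^+ 2).
Proof.
move=> dgP hh y0 hy; pose s := (dg y ^+ 2 - dg 0 ^+ 2) / y.
have s0 : 0 < s by rewrite divr_gt0// subr_gt0.
have dgs z : y <= z -> s * z <= dg z ^+ 2.
  move=> /(convex_secant_le hh y0); rewrite /s mulrAC ler_pdivrMr//.
  by have := mulr_ge0 (ltW y0) (sqr_ge0 (dg 0)); lra.
pose K := 9 / s * (1 + g y ^+ 2) + 2 * y ^+ 3.
have a0 : 0 < 9 / s by rewrite divr_gt0.
have b0 : 0 < y ^+ 3 by rewrite exprn_gt0.
have K0 : 0 <= K.
  by rewrite addr_ge0// mulr_ge0 ?ltW// ltr_wpDr ?sqr_ge0.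
exists K => // x x0.
have gx0 := sqr_ge0 (g x); have gy0 := sqr_ge0 (g y).
have [yx|/ltW xy] := leP y x; last first.
  have : x ^+ 3 <= y ^+ 3 by rewrite lerXn2r ?nnegrE// ltW.
  have := mulr_ge0 K0 gx0; have := mulr_ge0 (ltW a0) gy0.
  by rewrite /K; lra.
have xE : (x * Num.sqrt x) ^+ 2 = x ^+ 3 by rewrite exprMn sqr_sqrtr// -exprSr.
have yE : (y * Num.sqrt y) ^+ 2 = y ^+ 3.
  by rewrite exprMn sqr_sqrtr// ?ltW// -exprSr.
have := sqr_increment_ge_cube dgP y0 yx dgs.
set u := x * _ in xE *; set v := y * _ in yE * => uv.
have uv2 : 4 * (u - v) ^+ 2 <= 9 / s * (g x - g y) ^+ 2.
  by rewrite mulrAC ler_pdivlMr// mulrAC.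
rewrite /K -xE -yE.
have h1 : u ^+ 2 <= 2 * (u - v) ^+ 2 + 2 * v ^+ 2.
  by have := sqr_ge0 (u - 2 * v); lra.
have h2 : (g x - g y) ^+ 2 <= 2 * g x ^+ 2 + 2 * g y ^+ 2.
  by have := sqr_ge0 (g x + g y); lra.
have := ler_wpM2l (ltW a0) h2.
have := mulr_ge0 (ltW a0) (mulr_ge0 gx0 gy0).
have := mulr_ge0 gx0 (sqr_ge0 v).
have := sqr_ge0 v.
lra.
Qed.

(** The minimum bounds the Lipschitz envelope of constant L of (g')^2 at t, and
    x^2 times it bounds x times a primitive of that envelope. When (g')^2 exceeds
    its value at 0 somewhere on the half-line, the term in x^3 is absorbed by
    g^2; otherwise the minimum is bounded. *)
Lemma truncated_growth_nng (R : realType) (g dg : R -> R) (L : R) :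
  (forall z : R, is_derive z 1 g (dg z)) -> convex (fun z => dg z ^+ 2) ->
  0 <= L -> exists2 C : R, 0 <= C & forall t x : R, 0 <= t -> t <= x ->
  x ^+ 2 * Num.min (dg t ^+ 2) (dg 0 ^+ 2 + L * t) <= C * (1 + x ^+ 2 + g x ^+ 2).
Proof.
move=> dgP hh L0; have c0 := sqr_ge0 (dg 0).
have [[y y0 hy]|nh] := pselect (exists2 y, 0 < y & dg 0 ^+ 2 < dg y ^+ 2).
  have [K K0 KP] := cube_le_sqr dgP hh y0 hy.
  exists (dg 0 ^+ 2 + L * K) => [|t x t0 tx].
     exact: addr_ge0 c0 (mulr_ge0 L0 K0).
  have x0 : 0 <= x by exact: le_trans tx.
  have : x ^+ 2 * Num.min (dg t ^+ 2) (dg 0 ^+ 2 + L * t) <=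
      x ^+ 2 * (dg 0 ^+ 2 + L * x).
    by rewrite ler_wpM2l ?sqr_ge0// ge_min lerD2l ler_wpM2l ?orbT.
  have := ler_wpM2l L0 (KP x x0).
  have := mulr_ge0 (addr_ge0 c0 (mulr_ge0 L0 K0)) (sqr_ge0 x).
  have := mulr_ge0 c0 (sqr_ge0 (g x)); have := mulr_ge0 (mulr_ge0 L0 K0) (sqr_ge0 x).
  by rewrite exprS; lra.
exists (dg 0 ^+ 2) => // t x t0 tx.
have ht : dg t ^+ 2 <= dg 0 ^+ 2.
  rewrite leNgt; apply/negP => ht; apply: nh; exists t => //.
  by rewrite lt_neqAle t0 andbT; apply/eqP => E; move: ht; rewrite -E ltxx.
have : x ^+ 2 * Num.min (dg t ^+ 2) (dg 0 ^+ 2 + L * t) <= x ^+ 2 * dg 0 ^+ 2.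
  by rewrite ler_wpM2l ?sqr_ge0// ge_min ht.
by have := mulr_ge0 c0 (sqr_ge0 (g x)); lra.
Qed.

Lemma truncated_growth (R : realType) (g dg : R -> R) (L : R) :
  (forall z : R, is_derive z 1 g (dg z)) -> convex (fun z => dg z ^+ 2) ->
  0 <= L -> exists2 C : R, 0 <= C & forall t x : R, `|t| <= `|x| -> 0 <= t * x ->
  x ^+ 2 * Num.min (dg t ^+ 2) (dg 0 ^+ 2 + L * `|t|) <=
    C * (1 + x ^+ 2 + g x ^+ 2).
Proof.
move=> dgP hh L0.
have [C C0 CP] := truncated_growth_nng dgP hh L0.
pose gN : R -> R := g \o -%R.
have dgN (z : R) : is_derive z 1 gN (- dg (- z)).
  by rewrite -mulrN1; apply: is_derive1_comp.
have hN : convex (fun z => (- dg (- z)) ^+ 2).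
  apply/convexP => x y a b a0 b0 ab; rewrite !sqrrN.
  by rewrite opprD -!mulrN; exact: ((convexP _).1 hh).
have [D D0 DP] := truncated_growth_nng dgN hN L0.
exists (Num.max C D) => [|t x]; first by rewrite le_max C0.
have g0 : 0 <= 1 + x ^+ 2 + g x ^+ 2 by rewrite !addr_ge0 ?sqr_ge0.
have [x0 tx tx0|x0 tx tx0|] := ltgtP x 0.
- have t0 : t <= 0 by rewrite -(nmulr_lge0 _ x0).
  apply: le_trans (ler_wpM2r g0 (_ : D <= _)); last by rewrite le_max lexx orbT.
  move: tx; rewrite (ler0_norm t0) (ler0_norm (ltW x0)) => tx.
  have := DP (- t) (- x) (_ : 0 <= - t) tx.
  by rewrite /gN/= !opprK oppr0 !sqrrN; apply; rewrite oppr_ge0.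
- have t0 : 0 <= t by rewrite -(pmulr_lge0 _ x0).
  apply: le_trans (ler_wpM2r g0 (_ : C <= _)); last by rewrite le_max lexx.
  by move: tx; rewrite (ger0_norm t0) (ger0_norm (ltW x0)) => tx; exact: CP.
- by move=> x0 _ _; rewrite x0 in g0 *; rewrite {1}expr0n mul0r mulr_ge0 ?le_max ?C0.
Qed.

(** * Integrals of monotone sequences and second moments *)

Lemma le_integrable_EFin d (T : measurableType d) (R : realType)
    (mu : {measure set T -> \bar R}) (f g : T -> R) :
  measurable_fun setT f -> (forall x, `|f x| <= g x) ->
  mu.-integrable setT (EFin \o g) -> mu.-integrable setT (EFin \o f).
Proof.
move=> mf fg; apply: le_integrable => //; first exact/measurable_EFinP.
by move=> x _ /=; rewrite lee_fin (le_trans (fg x))// ler_norm.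
Qed.

Lemma ge0_eventually_cvg_integral d (T : measurableType d) (R : realType)
    (mu : {measure set T -> \bar R}) (f : nat -> T -> R) (l : T -> R) :
  (forall n, measurable_fun setT (f n)) -> (forall n x, 0 <= f n x) ->
  (forall x, nondecreasing_seq (f ^~ x)) ->
  (forall x, exists N, forall n, (N <= n)%N -> f n x = l x) ->
  (\int[mu]_x (f n x)%:E)%E @[n --> \oo] --> (\int[mu]_x (l x)%:E)%E.
Proof.
move=> mf f0 ndf fl.
have -> : (\int[mu]_x (l x)%:E = \int[mu]_x limn (fun n => (f n x)%:E))%E.
  apply: eq_integral => x _; apply/esym/cvg_lim => //.
  have [N NP] := fl x.
  by apply: cvg_near_cst; exists N => // n /= Nn; rewrite NP.
apply: cvg_monotone_convergence => //.
- by move=> n; exact/measurable_EFinP.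
- by move=> n x _; rewrite lee_fin.
- by move=> x _ m n mn; rewrite lee_fin; exact: ndf.
Qed.

Lemma integrable_sqr_Lfun2 d (T : measurableType d) (R : realType)
    (mu : {measure set T -> \bar R}) (X : T -> R) : measurable_fun setT X ->
  mu.-integrable setT (fun w => (X w ^+ 2)%:E) -> X \in Lfun mu 2%:E.
Proof.
move=> mX /integrableP[_ X2]; rewrite inE; apply/andP; split; rewrite inE//=.
rewrite /finite_norm unlock poweR_lty//; apply: le_lt_trans X2.
rewrite le_eqVlt; apply/orP; left; apply/eqP/eq_integral => w _ /=.
by rewrite powR_mulrn// normrX.
Qed.

Section second_moment.
Context d (T : measurableType d) (R : realType) (P : probability T R).
Variables (X : T -> R).
Hypothesis mX : measurable_fun setT X.

(** The expectation of X need not be finite: fine then returns 0, and the integral is the second moment of X. *)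
Lemma variance_integral :
  ('V_P[X] = \int[P]_w ((X w - fine 'E_P[X]) ^+ 2)%:E)%E.
Proof.
by rewrite /variance [in LHS]unlock unlock; apply: eq_integral => w _; rewrite expr2.
Qed.

Lemma integrable_sqr_of_variance : ('V_P[X])%E \is a fin_num ->
  P.-integrable setT (fun w => (X w ^+ 2)%:E).
Proof.
rewrite variance_integral; set m := fine _ => fin.
have mXm : measurable_fun setT (fun w => (X w - m) ^+ 2).
  by apply: measurable_funX; exact: measurable_funB.
have int : P.-integrable setT (EFin \o (fun w => 2 * (X w - m) ^+ 2 + 2 * m ^+ 2)).
  apply: (@integrableD _ _ _ P setT _ (fun w => (2 * (X w - m) ^+ 2)%:E)
            (EFin \o cst (2 * m ^+ 2))) => //; last first.
    exact: finite_measure_integrable_cst.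
  apply: (@integrableZl _ _ _ P setT _ 2 (fun w => ((X w - m) ^+ 2)%:E)) => //.
  apply/integrableP; split; first exact/measurable_EFinP.
  under eq_integral do rewrite gee0_abs ?lee_fin ?sqr_ge0//.
  by rewrite -ge0_fin_numE// integral_ge0// => w _; rewrite lee_fin sqr_ge0.
apply: (le_integrable_EFin _ _ int); first exact: measurable_funX.
by move=> w; rewrite ger0_norm ?sqr_ge0//; have := sqr_ge0 (X w - 2 * m); lra.
Qed.

(** The mean minimises the quadratic distance to a constant. *)
Lemma variance_le_sqr_dist (c : R) : ('V_P[X])%E \is a fin_num ->
  ('V_P[X] <= \int[P]_w ((X w - c) ^+ 2)%:E)%E.
Proof.
move=> /integrable_sqr_of_variance X2.
have XL : X \in Lfun P 2%:E by exact: integrable_sqr_Lfun2.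
have cL : cst c \in Lfun P 2%:E by exact: Lfun_cst.
rewrite -(varianceB_cst_r c XL) varianceE ?rpredB ?lee1n//.
rewrite [leLHS](_ : _ = \int[P]_w ((X w - c) ^+ 2)%:E - ('E_P[X \- cst c]) ^+ 2)%E.
  by rewrite -[leRHS]adde0 leeD2l// oppe_le0 sqre_ge0.
by rewrite unlock.
Qed.

End second_moment.

(** * Zero-biasing for nonnegative functions *)

Lemma bounded_derive_absolutely_continuous (R : realType) (K k : R -> R) (m : R) :
  (forall x : R, is_derive x 1 K (k x)) -> (forall x, `|k x| <= m) ->
  absolutely_continuous K.
Proof.
move=> dK km a b e e0.
have m0 : 0 < m + 1 by have := km 0; have := normr_ge0 (k 0); lra.
exists (e / (m + 1)) => [|n ab abP _ sum_lt]; first by rewrite divr_gt0.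
apply: (@le_lt_trans _ _ (\sum_(i < n) (m + 1) * ((ab i).2 - (ab i).1))).
  apply: ler_sum => i _; have [_ [abi _]] := abP i.
  have [t _ ->] := MVT_segment abi (fun y _ => dK y)
    (continuous_subspaceT (is_derive_continuous dK)).
  rewrite normrM (ger0_norm (_ : 0 <= _ - _)) ?subr_ge0//.
  by rewrite ler_wpM2r ?subr_ge0// (le_trans (km t))// lerDl.
by rewrite -mulr_sumr mulrC -ltr_pdivlMr.
Qed.

Lemma continuous_bounded_on_ball (R : realType) (k : R -> R) (r : R) :
  continuous k -> 0 <= r -> exists N, forall t, `|t| <= r -> k t <= N%:R.
Proof.
move=> ck r0; have [|c _ cP] := @EVT_max _ k (- r) r _ (continuous_subspaceT ck).
  by lra.
exists (Num.truncn `|k c|).+1 => t tr.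
rewrite (le_trans (cP t _)) ?in_itv/= -?ler_norml//.
by rewrite (le_trans (ler_norm _))// ltW// truncnS_gt.
Qed.

Section zero_bias.
Context d d' (T : measurableType d) (T' : measurableType d') (R : realType).
Context (P : probability T R) (Q : probability T' R).
Context (W : {RV P >-> R}) (Ws : {RV Q >-> R}).
Hypothesis W2 : P.-integrable setT (fun w => (W w ^+ 2)%:E).
Hypothesis V_fin : ('V_P[W])%E \is a fin_num.
Hypothesis zbW : zero_biased W Ws.

Let measurable_WK (K k : R -> R) : (forall x : R, is_derive x 1 K (k x)) ->
  measurable_fun setT (fun w => W w * K (W w)).
Proof.
move=> dK; apply: measurable_funM => //.
apply: (@measurableT_comp _ _ _ _ _ _ K) => //.
by apply: continuous_measurable_fun; exact: is_derive_continuous dK.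
Qed.

(** For bounded k both sides are integrable, W K(W) being dominated by m W^2. *)
Lemma zero_biased_bounded (K k : R -> R) (m : R) : continuous k ->
  (forall x, 0 <= k x) -> (forall x, k x <= m) ->
  (forall x : R, is_derive x 1 K (k x)) -> K 0 = 0 ->
  (\int[P]_w (W w * K (W w))%:E = 'V_P[W] * \int[Q]_w (k (Ws w))%:E)%E.
Proof.
move=> ck k0 km dK K0.
have k_norm x : `|k x| <= m by rewrite ger0_norm.
have m0 : 0 <= m := le_trans (k0 0) (km 0).
have dE : derive1 K = k.
  by apply/funext => x; rewrite derive1E; have [_ <-] := dK x.
have := zbW (bounded_derive_absolutely_continuous dK k_norm).
rewrite dE unlock; apply.
- apply/Lfun1_integrable; apply: (@le_integrable_EFin _ _ _ _ _ (fun w => m * W w ^+ 2)).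
  + exact: measurable_WK dK.
  + move=> w; have [t [_ _]] := mvt_from0 (W w) dK.
    rewrite K0 subr0 => ->; rewrite mulrCA -expr2 normrM normrX real_normK ?num_real//.
    by rewrite ler_wpM2r ?sqr_ge0.
  + exact: (@integrableZl _ _ _ P setT _ m (fun w => (W w ^+ 2)%:E)).
- apply/Lfun1_integrable; apply: (@le_integrable_EFin _ _ _ _ _ (cst m)).
  + apply: (@measurableT_comp _ _ _ _ _ _ k) => //.
    exact: continuous_measurable_fun.
  + by move=> w; exact: k_norm.
  + exact: finite_measure_integrable_cst.
Qed.

(** Truncate k at height n. On the segment between 0 and W w the function k is
    bounded, so the primitives of the truncations coincide there with K as soon
    as n is large; both sides increase with n, and monotone convergence
    applies. *)
Lemma zero_biased_nneg (K k : R -> R) : continuous k -> (forall x, 0 <= k x) ->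
  (forall x : R, is_derive x 1 K (k x)) -> K 0 = 0 ->
  (\int[P]_w (W w * K (W w))%:E = 'V_P[W] * \int[Q]_w (k (Ws w))%:E)%E.
Proof.
move=> ck k0 dK K0.
pose kn n (x : R) := Num.min (k x) n%:R.
have ckn n : continuous (kn n).
  by move=> x; apply: (@continuous_min _ _ k (cst n%:R)); [exact: ck|exact: cvg_cst].
have kn0 n x : 0 <= kn n x by rewrite le_min k0 ler0n.
have knm n x : kn n x <= n%:R by rewrite ge_min lexx orbT.
pose Kn n := sval (cid2 (exists_primitive (ckn n))).
have dKn n (x : R) : is_derive x 1 (Kn n) (kn n x).
  by rewrite /Kn; case: cid2.
have Kn0 n : Kn n 0 = 0 by rewrite /Kn; case: cid2.
have kn_nd n m x : (n <= m)%N -> kn n x <= kn m x.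
  by move=> nm; rewrite le_min2 ?ler_nat.
have lhs : (\int[P]_w (W w * Kn n (W w))%:E)%E @[n --> \oo] -->
    (\int[P]_w (W w * K (W w))%:E)%E.
  apply: ge0_eventually_cvg_integral => [n|n w|w n m nm|w].
  - exact: measurable_WK (dKn n).
  - by apply: mul_primitive_ge0 (dKn n) _ _.
  - by apply: le_mul_primitive (dKn n) _ (dKn m) _ _ => // t _; exact: kn_nd.
  - have [N NP] := continuous_bounded_on_ball ck (normr_ge0 (W w)).
    exists N => n Nn; have knE t : `|t| <= `|W w| -> kn n t = k t.
      by move=> /NP h; apply/min_idPl; rewrite (le_trans h)// ler_nat.
    apply/eqP; rewrite eq_le; apply/andP; split.
    + by apply: le_mul_primitive (dKn n) _ dK _ _ => // t /knE ->.
    + by apply: le_mul_primitive dK _ (dKn n) _ _ => // t /knE ->.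
have rhs : (\int[Q]_w (kn n (Ws w))%:E)%E @[n --> \oo] -->
    (\int[Q]_w (k (Ws w))%:E)%E.
  apply: ge0_eventually_cvg_integral => [n|n w|w n m nm|w].
  - apply: (@measurableT_comp _ _ _ _ _ _ (kn n)) => //.
    exact: continuous_measurable_fun.
  - exact: kn0.
  - exact: kn_nd.
  - exists (Num.truncn (k (Ws w))).+1 => n Nn; apply/min_idPl.
    by rewrite (le_trans (ltW (truncnS_gt _)))// ler_nat.
have zn n : (\int[P]_w (W w * Kn n (W w))%:E =
    'V_P[W] * \int[Q]_w (kn n (Ws w))%:E)%E.
  by apply: zero_biased_bounded (ckn n) _ (knm n) (dKn n) _.
rewrite (funext zn) in lhs.
exact: cvg_unique lhs (cvgeZl V_fin rhs).
Qed.

End zero_bias.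

(** * The convex order and the conclusion *)

(** A nonzero variance is what allows the finiteness of E[W Hn(W)] to be read, by
    zero-biasing, as the integrability of hn(Ws). *)
Lemma convex_order_sqr_derive d d' (T : measurableType d) (T' : measurableType d')
    (R : realType) (P : probability T R) (Q : probability T' R)
    (W : {RV P >-> R}) (Ws : {RV Q >-> R}) (g dg : R -> R) :
  P.-integrable setT (fun w => (W w ^+ 2)%:E) ->
  ('V_P[W])%E \is a fin_num -> ('V_P[W] != 0)%E ->
  zero_biased W Ws -> convex_order Ws W ->
  (forall x : R, is_derive x 1 g (dg x)) ->
  P.-integrable setT (fun w => (g (W w) ^+ 2)%:E) ->
  convex (fun x => dg x ^+ 2) ->
  (\int[Q]_w (dg (Ws w) ^+ 2)%:E <= \int[P]_w (dg (W w) ^+ 2)%:E)%E.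
Proof.
move=> W2 V_fin V0 zbW ordW dgP gW2 hh.
pose h x := dg x ^+ 2; have h0 x : 0 <= h x by exact: sqr_ge0.
pose hn n := lipschitz_envelope h n%:R.
have hn0 n x : 0 <= hn n x by exact: lipschitz_envelope_ge0.
have hn_le n x : hn n x <= h x by exact: lipschitz_envelope_le_id.
have hn_growth n x : hn n x <= h 0 + n%:R * `|x|.
  by rewrite -[x in `|x|]subr0; exact: lipschitz_envelope_le.
have hn_convex n : convex (hn n) by exact: lipschitz_envelope_convex.
have hn_cont n : continuous (hn n) by exact: convex_continuous.
have mh : measurable_fun setT h.
  by apply: continuous_measurable_fun; exact: convex_continuous.
have mhn n : measurable_fun setT (hn n) by exact: continuous_measurable_fun.
have hnW n : hn n \o W \in Lfun P 1%E.
  have int : P.-integrable setT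
      (EFin \o (fun w => n%:R * W w ^+ 2 + (h 0 + n%:R))).
    apply: (@integrableD _ _ _ P setT _ (fun w => (n%:R * W w ^+ 2)%:E)
              (EFin \o cst (h 0 + n%:R))) => //; last first.
      exact: finite_measure_integrable_cst.
    exact: (@integrableZl _ _ _ P setT _ n%:R (fun w => (W w ^+ 2)%:E)).
  apply/Lfun1_integrable; apply: (le_integrable_EFin _ _ int).
    exact: measurableT_comp.
  move=> w /=; rewrite ger0_norm// (le_trans (hn_growth n _))//.
  rewrite addrCA lerD2l -[X in _ + X]mulr1 -mulrDr ler_wpM2l//.
  by have := sqr_ge0 (`|W w| - 1); rewrite -(real_normK (num_real (W w))); nra.
have hnWs n : hn n \o Ws \in Lfun Q 1%E.
  have [Hn dHn Hn0] := exists_primitive (hn_cont n).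
  have [C C0 CP] := truncated_growth dgP hh (ler0n R n).
  have WHn_fin : (\int[P]_w (W w * Hn (W w))%:E < +oo)%E.
    have int : P.-integrable setT
        (EFin \o (fun w => C * (1 + W w ^+ 2 + g (W w) ^+ 2))).
      apply: (@integrableZl _ _ _ P setT _ C
        (fun w => (1 + W w ^+ 2 + g (W w) ^+ 2)%:E)) => //.
      apply: (@integrableD _ _ _ P setT _ (fun w => (1 + W w ^+ 2)%:E)
        (fun w => (g (W w) ^+ 2)%:E)) => //.
      apply: (@integrableD _ _ _ P setT _ (EFin \o cst 1)
        (fun w => (W w ^+ 2)%:E)) => //.
      exact: finite_measure_integrable_cst.
    have /integrable_lty : P.-integrable setT (EFin \o (fun w => W w * Hn (W w))).
      apply: (le_integrable_EFin _ _ int).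
        apply: measurable_funM => //; apply: (@measurableT_comp _ _ _ _ _ _ Hn) => //.
        by apply: continuous_measurable_fun; exact: is_derive_continuous dHn.
      move=> w; rewrite ger0_norm ?(mul_primitive_ge0 dHn)//.
      have [t [tW tW0]] := mvt_from0 (W w) dHn; rewrite Hn0 subr0 => ->.
      rewrite mulrCA -expr2 mulrC (le_trans _ (CP t _ tW tW0))//.
      by rewrite ler_wpM2l ?sqr_ge0// le_min hn_le hn_growth.
    exact.
  apply/Lfun1_integrable/integrableP; split.
    by apply/measurable_EFinP; exact: measurableT_comp.
  under eq_integral do rewrite /= ger0_norm//.
  move: WHn_fin; rewrite (zero_biased_nneg W2 V_fin zbW (hn_cont n) _ dHn)//.
  have V_gt0 : (0 < 'V_P[W])%E by rewrite lt_neqAle eq_sym V0 variance_ge0.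
  by case: integral => [r||]//; rewrite ?ltry ?ltNyr// gt0_muley// ltxx.
have hn_order n : (\int[Q]_w (hn n (Ws w))%:E <= \int[P]_w (h (W w))%:E)%E.
  have := ordW _ (hn_convex n) (hnWs n) (hnW n); rewrite unlock => /le_trans; apply.
  apply: ge0_le_integral => //.
  - by move=> w _; rewrite lee_fin hn0.
  - by apply/measurable_EFinP; exact: measurableT_comp.
  - by apply/measurable_EFinP; exact: measurableT_comp.
  - by move=> w _; rewrite lee_fin; exact: hn_le.
have hn_cvg : (\int[Q]_w (hn n (Ws w))%:E)%E @[n --> \oo] -->
    (\int[Q]_w (h (Ws w))%:E)%E.
  apply: ge0_eventually_cvg_integral => [n|n w|w n m nm|w].
  - exact: (measurableT_comp (mhn n)).
  - exact: hn0.
  - by apply: lipschitz_envelope_nd; rewrite ?ler_nat.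
  - pose M := `|Ws w|.
    exists (Num.truncn (h (M + 1) + h (- (M + 1)))).+1 => n Nn.
    apply: (lipschitz_envelope_eq h0 hh (lexx M)).
    by rewrite (le_trans (ltW (truncnS_gt _)))// ler_nat.
rewrite -(cvg_lim _ hn_cvg)//; apply: lime_le; last exact: nearW.
by apply/cvg_ex; eexists; exact: hn_cvg.
Qed.

Theorem theorem4p1 (R : realType) (d d' : measure_display)
    (T : measurableType d) (T' : measurableType d')
    (P : probability T R) (Q : probability T' R)
    (W : {RV P >-> R}) (Ws : {RV Q >-> R}) (sigma : R)
    (mean_W : ('E_P[W] = 0)%E)
    (var_W : ('V_P[W] = (sigma ^+ 2)%:E)%E)
    (zero_biased_Ws : zero_biased W Ws)
    (order_Ws_W : convex_order Ws W)
    (g : R -> R)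
    (derivable_g : forall x : R, derivable g x 1)
    (var_gW : ('V_P[g \o W])%E \is a fin_num)
    (convex_dg2 : convex (fun x : R => derive1 g x ^+ 2)) :
  ('V_P[g \o W] <= (sigma ^+ 2)%:E * 'E_P[fun w => (derive1 g (W w) ^+ 2)%R])%E.
Proof.
have V_fin : ('V_P[W])%E \is a fin_num by rewrite var_W.
have dgP (x : R) : is_derive x 1 g (derive1 g x).
  by rewrite derive1E; apply: DeriveDef.
have mgW : measurable_fun setT (g \o W).
  apply: measurableT_comp => //; apply: continuous_measurable_fun.
  exact: is_derive_continuous dgP.
have W2 := integrable_sqr_of_variance (measurable_funPT W) V_fin.
have gW2 := integrable_sqr_of_variance mgW var_gW.
have h0 x : 0 <= derive1 g x ^+ 2 by exact: sqr_ge0.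
have ch := convex_continuous convex_dg2 h0.
have [H dH H0] := exists_primitive ch.
have mH : measurable_fun setT H.
  by apply: continuous_measurable_fun; exact: is_derive_continuous dH.
apply: (le_trans (variance_le_sqr_dist mgW (g 0) var_gW)).
apply: (@le_trans _ _ (\int[P]_w (W w * H (W w))%:E)%E).
  apply: ge0_le_integral => //.
  - by move=> w _; rewrite lee_fin sqr_ge0.
  - by apply/measurable_EFinP; apply: measurable_funX; exact: measurable_funB.
  - apply/measurable_EFinP; apply: measurable_funM => //; exact: measurableT_comp.
  - by move=> w _; rewrite lee_fin; exact: sqr_increment_le dgP dH H0.
rewrite (zero_biased_nneg W2 V_fin zero_biased_Ws ch h0 dH H0) -var_W unlock.
(* in the degenerate case both products vanish, even if an expectation is infinite *)
have [->|V0] := eqVneq ('V_P[W])%E 0%E; first by rewrite !mul0e.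
apply: lee_wpmul2l; first exact: variance_ge0.
exact: (convex_order_sqr_derive W2 V_fin V0 zero_biased_Ws order_Ws_W dgP gW2).
Qed.
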